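(* Let $(X,\mathcal{A},\mu)$ be a measure space and let $I$ be an ideal of the ring $\mathcal{M}(X,\mathcal{A})$. Then $I\mu(X,\mathcal{A})$ is an ideal of the ring $\mathcal{M}(X,\mathcal{A})$, and $I\subseteq I\mu(X,\mathcal{A})\subseteq L_I^\infty(\mu)$.
   Context: $X$ is a non-empty set, $\mathcal{A}$ a $\sigma$-algebra on $X$, and $\mu:\mathcal{A}\to[0,\infty]$ a measure. $\mathcal{M}(X,\mathcal{A})$ is the commutative ring with unity of all real-valued $\mathcal{A}$-measurable functions on $X$, with pointwise operations. For $g\in\mathcal{M}(X,\mathcal{A})$, $Z(g)=\{x\in X: g(x)=0\}$, and for an ideal $I$, $Z[I]=\{Z(g): g\in I\}$. Null sets $E$ below are always members of $\mathcal{A}$. $L_I^\infty(\mu)$ is the set of all $f\in\mathcal{M}(X,\mathcal{A})$ for which there exist $Z\in Z[I]$ and $E\subseteq Z$ with $\mu(E)=0$ such that $f$ is bounded on $Z\setminus E$. $I\mu(X,\mathcal{A})$ is the set of all $f\in\mathcal{M}(X,\mathcal{A})$ such that for every $g\in\mathcal{M}(X,\mathcal{A})$ there exist $Z\in Z[I]$ and $E\subseteq Z$ with $\mu(E)=0$ such that $fg$ is bounded on $Z\setminus E$. (In the conclusion, ''ideal'' allows the whole ring.) *)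

(* Defs.v *)
From HB Require Import structures.
From mathcomp Require Import all_boot all_order all_algebra.
From mathcomp Require Import all_classical all_reals all_analysis.
From mathcomp Require Import measurable_realfun.

Set Implicit Arguments.
Unset Strict Implicit.
Unset Printing Implicit Defensive.

Import Order.TTheory GRing.Theory Num.Theory.
Import numFieldNormedType.Exports.

Local Open Scope classical_set_scope.
Local Open Scope ring_scope.

(* Not necessarily proper, unlike [idealr_closed] of ring_quotient, which
   requires [1 \notin J]. *)
Definition is_ideal (A : comNzRingType) (J : set A) : Prop :=
  [/\ J 0,
      forall f g, J f -> J g -> J (f + g)
    & forall h f, J f -> J (h * f)].

(* [measurableType]s are pointed, so X is non-empty; [{mfun X >-> R}] carries
   the library's commutative ring structure, with pointwise operations. *)
Section Linf_ideal.
Context (R : realType) (d : measure_display) (X : measurableType d).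
Implicit Types (I : set {mfun X >-> R}) (mu : {measure set X -> \bar R}).

Definition zero_set (g : {mfun X >-> R}) : set X := [set x | g x = 0].

(* Z[I] *)
Definition zero_sets I : set (set X) := [set zero_set g | g in I].

(* L_I^oo(mu) *)
Definition Linf_mod mu I : set {mfun X >-> R} :=
  [set f : {mfun X >-> R} | exists Z E : set X,
    [/\ zero_sets I Z, E `<=` Z, measurable E, mu E = 0%E
      & [bounded f x | x in Z `\` E]]].

(* I mu(X, A) *)
Definition Imu mu I : set {mfun X >-> R} :=
  [set f : {mfun X >-> R} | forall g : {mfun X >-> R}, exists Z E : set X,
    [/\ zero_sets I Z, E `<=` Z, measurable E, mu E = 0%E
      & [bounded (f * g : {mfun X >-> R}) x | x in Z `\` E]]].

End Linf_ideal.

(* Main.v *)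
Require Import Defs.
From HB Require Import structures.
From mathcomp Require Import all_boot all_order all_algebra.
From mathcomp Require Import all_classical all_reals all_analysis.
From mathcomp Require Import measurable_realfun.

Import Order.TTheory GRing.Theory Num.Theory.
Import numFieldNormedType.Exports.

Local Open Scope classical_set_scope.
Local Open Scope ring_scope.

(** By definition [f] belongs to [Imu mu I] exactly when [f * g] belongs to
    [Linf_mod mu I] for every [g], so everything reduces to two properties of
    [Linf_mod mu I]: it contains [I] ([ideal_sub_Linf_mod]), and it is closed
    under addition ([Linf_modD]).  The first holds because [f] vanishes, hence
    is bounded, on its own zero set.  For the second, two functions bounded on
    different zero sets have to be compared on a common one: the intersection
    of the zero sets of [u] and [v] is the zero set of [u * u + v * v], which is
    again in [I].  This is where it matters that the functions are real.
    Since [f * g] stays in [I] when [f] does, the first property gives the lower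
    bound [I `<=` Imu mu I]; the choice [g = 1] gives the upper bound, and
    distributivity and associativity give the ideal axioms for [Imu mu I]. *)

Lemma bounded_onP (R : realType) (T : Type) (f : T -> R) (A : set T) :
  [bounded f x | x in A] <-> exists M : R, forall x, A x -> `|f x| <= M.
Proof.
split.
  by move=> /pinfty_ex_gt0[M _ fM]; exists M => x Ax; exact: fM.
move=> [M fM]; exists M; split; first exact: num_real.
by move=> N MN x Ax; exact: le_trans (fM x Ax) (ltW MN).
Qed.

Section Linf_mod_theory.
Context (R : realType) (d : measure_display) (X : measurableType d).
Implicit Types (I : set {mfun X >-> R}) (mu : {measure set X -> \bar R}).

Lemma measurable_zero_set (g : {mfun X >-> R}) : measurable (zero_set g).
Proof.
rewrite (_ : zero_set g = g @^-1` [set 0]); last by [].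
by rewrite -[_ @^-1` _]setTI; exact: (measurable_funP g).
Qed.

(** Over the reals a sum of two squares vanishes only where both terms do. *)
Lemma zero_setI (u v : {mfun X >-> R}) :
  zero_set (u * u + v * v) = zero_set u `&` zero_set v.
Proof.
apply/seteqP; split=> x.
  move=> uv0; have /eqP : u x ^+ 2 + v x ^+ 2 = 0 := uv0.
  by rewrite paddr_eq0 ?sqr_ge0// !sqrf_eq0 => /andP[/eqP ux0 /eqP vx0].
move=> [ux0 vx0]; suff : u x ^+ 2 + v x ^+ 2 = 0 by [].
by rewrite (ux0 : u x = 0) (vx0 : v x = 0) expr0n addr0.
Qed.

Lemma zero_setsI I (Z W : set X) : is_ideal I ->
  zero_sets I Z -> zero_sets I W -> zero_sets I (Z `&` W).
Proof.
move=> [_ ID IM] [u Iu <-] [v Iv <-].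
by exists (u * u + v * v); [apply: ID; exact: IM | exact: zero_setI].
Qed.

Lemma measurable_zero_sets I (Z : set X) : zero_sets I Z -> measurable Z.
Proof. by move=> [u _ <-]; exact: measurable_zero_set. Qed.

Lemma ideal_sub_Linf_mod mu I : I `<=` Linf_mod mu I.
Proof.
move=> f If; exists (zero_set f), set0; split=> //; first by exists f.
apply/bounded_onP; exists 0 => x [fx0 _].
by rewrite (fx0 : f x = 0) normr0.
Qed.

Lemma Linf_modD mu I (f g : {mfun X >-> R}) : is_ideal I ->
  Linf_mod mu I f -> Linf_mod mu I g -> Linf_mod mu I (f + g).
Proof.
move=> idI [Z [E [IZ EZ mE E0 /bounded_onP[M fM]]]].
move=> [W [F [IW FW mF F0 /bounded_onP[N gN]]]].
(* [E `|` F] has to be cut down, as it need not lie inside [Z `&` W]. *)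
have mZW := measurableI _ _ (measurable_zero_sets _ _ IZ)
  (measurable_zero_sets _ _ IW).
exists (Z `&` W), ((E `|` F) `&` (Z `&` W)); split.
- exact: zero_setsI.
- exact: subIsetr.
- by apply: measurableI => //; exact: measurableU.
- apply: (subset_measure0 (B := E `|` F)).
  + by apply: measurableI => //; exact: measurableU.
  + exact: measurableU.
  + exact: subIsetl.
  + exact: null_set_setU.
- apply/bounded_onP; exists (M + N) => x [[Zx Wx] EFx].
  apply: le_trans (ler_normD _ _) _; apply: lerD.
    by apply: fM; split=> // Ex; apply: EFx; split; [left|].
  by apply: gN; split=> // Fx; apply: EFx; split; [right|].
Qed.

End Linf_mod_theory.

Theorem theorem2p3 (R : realType) (d : measure_display) (X : measurableType d)
    (mu : {measure set X -> \bar R}) (I : set {mfun X >-> R}) :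
  is_ideal I ->
  [/\ is_ideal (Imu mu I), I `<=` Imu mu I & Imu mu I `<=` Linf_mod mu I].
Proof.
move=> idI; have [I0 _ IM] := idI.
have ImuE f : Imu mu I f = forall g, Linf_mod mu I (f * g) by [].
have subImu : I `<=` Imu mu I.
  move=> f If; rewrite ImuE => g.
  by rewrite mulrC; apply: ideal_sub_Linf_mod; exact: IM.
split=> //; last first.
  by move=> f; rewrite ImuE => /(_ 1); rewrite mulr1.
split; first exact: subImu.
- move=> f g; rewrite !ImuE => If Ig h.
  by rewrite mulrDl; apply: Linf_modD => //.
- move=> h f; rewrite !ImuE => If g.
  by rewrite [h * f]mulrC -mulrA; exact: If.
Qed.
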